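(* Let $M$ be a metric space (with a fixed point $0$) that is either unbounded or not uniformly discrete. Then $\mathrm{Lip}_0(M)$ contains a Daugavet-point.
   Context: A metric space $(M,d)$ is uniformly discrete if $\inf\{d(x,y):x,y\in M,\ x\ne y\}>0$. For a metric space $(M,d)$ with a fixed point $0\in M$, $\mathrm{Lip}_0(M)$ is the real Banach space of all Lipschitz functions $f:M\to\mathbb{R}$ with $f(0)=0$, normed by the Lipschitz constant. For a real Banach space $X$ with closed unit ball $B_X$ and unit sphere $S_X$, a point $x\in S_X$ is a Daugavet-point if $B_X=\overline{\mathrm{conv}}\{y\in B_X:\|x-y\|\ge2-\varepsilon\}$ for every $\varepsilon>0$. *)

(* Defs.v *)
From HB Require Import structures.
From mathcomp Require Import all_boot all_order all_algebra.
From mathcomp Require Import all_classical all_reals all_analysis.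
From mathcomp Require Import ring.

Set Implicit Arguments.
Unset Strict Implicit.
Unset Printing Implicit Defensive.

Import Order.TTheory GRing.Theory Num.Theory.
Import numFieldNormedType.Exports.

Local Open Scope classical_set_scope.
Local Open Scope ring_scope.

Section metric_predicates.
Context {R : realType} (M : metricType R).

(* The infimum is taken in the extended reals, so that a one-point space,
   where the set of distances is empty, is uniformly discrete. *)
Definition uniformly_discrete : Prop :=
  (0 < ereal_inf [set (mdist p.1 p.2)%:E | p in [set p : M * M | p.1 <> p.2]])%E.

Definition metric_bounded : Prop :=
  exists C : R, forall x y : M, mdist x y <= C.

End metric_predicates.

Section Lip0.
Context {R : realType} {M : metricType R}.

Definition is_lipschitz (f : M -> R) : Prop :=
  exists k : R, forall x y, `|f x - f y| <= k * mdist x y.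

(* On a one-point space the set of slopes is empty and its [sup] is 0. *)
Definition lip_const (f : M -> R) : R :=
  sup [set `|f p.1 - f p.2| / mdist p.1 p.2 | p in [set p : M * M | p.1 <> p.2]].

(* [R^o] is [R] seen as a module over itself; it gives [M -> R^o] its module
   structure. *)
Definition lip0_pred (o : M) : {pred M -> R^o} :=
  fun f => `[< f o = 0 /\ is_lipschitz f >].

Record Lip0 (o : M) := MkLip0 {
  lip0_fun :> M -> R^o ;
  lip0_funP : lip0_fun \in lip0_pred o }.

HB.instance Definition _ (o : M) := [isSub for @lip0_fun o].
HB.instance Definition _ (o : M) := [Choice of Lip0 o by <:].

End Lip0.

Section Lip0_normed.
Context {R : realType} {M : metricType R} (o : M).
Implicit Types f g : Lip0 o.

Lemma lip0_o f : f o = 0.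
Proof. by have /asboolP[] := lip0_funP f. Qed.

Lemma lip0_lipschitz f : is_lipschitz f.
Proof. by have /asboolP[] := lip0_funP f. Qed.

Lemma lip0_submod_closed : submod_closed (@lip0_pred R M o).
Proof.
split=> [|a f g /asboolP[f0 [k fk]] /asboolP[g0 [l gl]]]; apply/asboolP.
  by split=> //; exists 0 => x y; rewrite subrr normr0 mul0r.
split; first by rewrite /= !fctE f0 g0 scaler0 addr0.
exists (`|a| * k + l) => x y; rewrite !fctE opprD addrACA -scalerBr.
rewrite (le_trans (ler_normD _ _))// mulrDl lerD// normrM -mulrA.
by rewrite ler_wpM2l.
Qed.

HB.instance Definition _ :=
  GRing.isSubmodClosed.Build R (M -> R^o) (@lip0_pred R M o) lip0_submod_closed.

HB.instance Definition _ := [SubChoice_isSubLmodule of Lip0 o by <:].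

Lemma lip_const_has_ubound f : has_ubound
  [set `|f p.1 - f p.2| / mdist p.1 p.2 | p in [set p : M * M | p.1 <> p.2]].
Proof.
have [k fk] := lip0_lipschitz f; exists k => _ [[x y] /= /eqP xy <-].
by rewrite ler_pdivrMr ?mdist_gt0.
Qed.

Lemma lip_const_ge0 (f : M -> R) : 0 <= lip_const f.
Proof.
rewrite /lip_const; set A := (X in sup X).
have [hA|] := pselect (has_sup A); last by move/sup_out => ->.
have [[r Ar] ubA] := hA; apply: le_trans (ub_le_sup ubA Ar).
by case: Ar => p _ <-; rewrite divr_ge0 ?mdist_ge0.
Qed.

Lemma lip_constP f x y : `|f x - f y| <= lip_const f * mdist x y.
Proof.
have [->|xy] := eqVneq x y; first by rewrite subrr normr0 mdistxx mulr0.
rewrite -ler_pdivrMr ?mdist_gt0//.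
apply: ub_le_sup; first exact: lip_const_has_ubound.
by exists (x, y) => //=; exact/eqP.
Qed.

Lemma lip_const_le (f : M -> R) k : 0 <= k ->
  (forall x y, `|f x - f y| <= k * mdist x y) -> lip_const f <= k.
Proof.
move=> k0 fk; rewrite /lip_const; set A := (X in sup X).
have [->|/set0P A0] := eqVneq A set0; first by rewrite sup0.
apply: ge_sup => // _ [[x y] /= /eqP xy <-].
by rewrite ler_pdivrMr ?mdist_gt0.
Qed.

Lemma lip_constD f g : lip_const (f + g) <= lip_const f + lip_const g.
Proof.
apply: lip_const_le; first by rewrite addr_ge0 ?lip_const_ge0.
move=> x y; rewrite /= !fctE opprD addrACA mulrDl.
by rewrite (le_trans (ler_normD _ _))// lerD ?lip_constP.
Qed.

Let lip_constZ_le a f : lip_const (a *: f) <= `|a| * lip_const f.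
Proof.
apply: lip_const_le; first by rewrite mulr_ge0 ?lip_const_ge0.
move=> x y; rewrite /= !fctE -scalerBr normrM -mulrA.
by rewrite ler_wpM2l ?lip_constP.
Qed.

Lemma lip_constZ a f : lip_const (a *: f) = `|a| * lip_const f.
Proof.
apply/eqP; rewrite eq_le lip_constZ_le/=.
have [->|a0] := eqVneq a 0; first by rewrite normr0 mul0r lip_const_ge0.
rewrite -ler_pdivlMl ?normr_gt0// -normfV.
by rewrite -{1}[f](scalerK a0) lip_constZ_le.
Qed.

Lemma lip_const_eq0 f : lip_const f = 0 -> f = 0.
Proof.
move=> f0; apply: val_inj; apply/funext => x /=.
by have := lip_constP f x o; rewrite f0 mul0r lip0_o subr0 normr_le0 => /eqP.
Qed.

HB.instance Definition _ := @Lmodule_isNormed.Build R (Lip0 o)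
  (fun f => lip_const f) lip_constD lip_constZ lip_const_eq0.

Lemma lip0_normE f : `|f| = lip_const f. Proof. by []. Qed.

Lemma lip0_complete (F : set_system (Lip0 o)) :
  ProperFilter F -> cauchy F -> cvg F.
Proof.
move=> FF /cauchyP Fc.
have Fd (e : R) : 0 < e -> exists g, \forall f \near F, `|g - f| < e.
  by move=> e0; have [g Fg] := Fc e e0; exists g; rewrite -ball_normE in Fg.
pose h x : R^o := lim ((f : Lip0 o) x @[f --> F]).
have hcvg x : (f : Lip0 o) x @[f --> F] --> h x.
  apply: (@cauchy_cvg R^o); apply/cauchy_exP => e e0.
  have d0 : 0 < mdist x o + 1 by rewrite ltr_wpDl ?mdist_ge0.
  have [g Fg] := Fd (e / (mdist x o + 1)) (divr_gt0 e0 d0).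
  exists (g x); rewrite -ball_normE.
  suff: \forall f \near F, `|g x - (f : Lip0 o) x| < e by [].
  near=> f.
  have := lip_constP (g - f) x o; rewrite /= !fctE !lip0_o subrr subr0 => gf.
  apply: le_lt_trans gf _.
  apply: (@le_lt_trans _ _ (e / (mdist x o + 1) * mdist x o)).
    by rewrite ler_wpM2r ?mdist_ge0// ltW//; near: f.
  by rewrite mulrAC ltr_pdivrMr// ltr_pM2l// ltrDl.
have gh (e : R) g : (\forall f \near F, `|g - f| < e) ->
    forall x y, `|(g x - h x) - (g y - h y)| <= e * mdist x y.
  move=> Fg x y; apply/ler_addgt0Pr => d d0.
  have d2 : 0 < d / 2 by rewrite divr_gt0.
  near F => f.
  have -> : (g x - h x) - (g y - h y) =
      ((g - f) x - (g - f) y) + ((f x - h x) + (h y - f y)).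
    by rewrite /= !fctE; ring.
  apply: (le_trans (ler_normD _ _)); apply: lerD.
    apply: le_trans (lip_constP (g - f) x y) _.
    by rewrite ler_wpM2r ?mdist_ge0// ltW//; near: f.
  rewrite (splitr d); apply: (le_trans (ler_normD _ _)); apply: lerD.
    by rewrite distrC; near: f; exact: cvgr_dist_le (hcvg x) _ d2.
  by near: f; exact: cvgr_dist_le (hcvg y) _ d2.
have h0P : h \in lip0_pred o.
  apply/asboolP; split.
    apply: cvg_lim => //; apply: cvg_near_cst.
    by near=> f; rewrite lip0_o.
  have [g /gh gh1] := Fd 1 ltr01; have [k gk] := lip0_lipschitz g.
  exists (k + 1) => x y.
  have -> : h x - h y = (g x - g y) - ((g x - h x) - (g y - h y)) by ring.
  by rewrite (le_trans (ler_normB _ _))// mulrDl lerD.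
apply/cvg_ex; exists (MkLip0 h0P); apply/cvgrPdist_le => e e0.
have e2 : 0 < e / 2 by rewrite divr_gt0.
have [g Fg] := Fd _ e2.
near=> f; rewrite (splitr e) -(subrKA g); apply: (le_trans (ler_normD _ _)).
apply: lerD; last by rewrite ltW//; near: f.
rewrite distrC; apply: lip_const_le; first exact: ltW.
by move=> x y; rewrite /= !fctE; exact: gh.
Unshelve. all: by end_near. Qed.

HB.instance Definition _ := Uniform_isComplete.Build (Lip0 o) lip0_complete.

End Lip0_normed.

Section daugavet.
Context {R : realType} (X : completeNormedModType R).

Definition convex_hull (A : set X) : set X := smallest (@convex_set R X) A.

Definition daugavet_point (x : X) : Prop :=
  `|x| = 1 /\
  forall e : R, 0 < e ->
    [set y : X | `|y| <= 1] =
    closure (convex_hull [set y : X | `|y| <= 1 /\ 2 - e <= `|x - y|]).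

End daugavet.

(* Main.v *)
(** Call [f] flippable if it is 1-Lipschitz and every 1-Lipschitz [g] has
    infinitely many perturbations [G n] with Lipschitz constant at most [1 + d],
    such that the functions [G n - g] have pairwise disjoint supports and
    [f - G n] has a slope at least [2 - d]. At two given points at most two of
    the [G n - g] are nonzero, so the mean of the first [N] perturbations is at
    distance [O(1 / N)] from [g]; hence [f - f o] is a Daugavet-point.

    To perturb [g], prescribe its value at a single point [x] and clip it by the
    cones of slope [1 + d] with apex at that value. This changes [g] only
    locally in two situations.
    - [f = phi] is the distance to a point [p] of the completion of [M], and the
      points [x] have distances to [p] at widely different scales: clipping
      changes [g] only where [phi] is comparable to [phi x]. This covers the
      unbounded case ([p = o]) and the case of a Cauchy family of close pairs.
    - There are pairs [x_n <> y_n] with [d(x_n, y_n) -> 0] and the [x_n]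
      uniformly separated, and [f] is the distance to the set of all [y_n]:
      clipping changes [g] only near [x_n].
    If [M] is not uniformly discrete, then either the points having a close
    neighbour yield the second configuration, or they are totally bounded in
    the limit and an ultrafilter on them converges to a suitable [p]. *)
Require Import Defs.
From mathcomp Require Import all_boot all_order all_algebra.
From mathcomp Require Import all_classical all_reals all_analysis.
From mathcomp Require Import lra.

Set Implicit Arguments.
Unset Strict Implicit.
Unset Printing Implicit Defensive.

Import Order.TTheory GRing.Theory Num.Theory.
Import numFieldNormedType.Exports.

Local Open Scope classical_set_scope.
Local Open Scope ring_scope.

(** * Convexity: means and the unit ball *)

Section convexity.
Context {R : realType} {X : normedModType R}.

Lemma convex_set_comb (A : set X) (t : R) (x y : X) :
  convex_set A -> 0 <= t -> t <= 1 -> A x -> A y -> A (t *: x + (1 - t) *: y).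
Proof.
move=> cA t0 t1 Ax Ay.
by have /set_mem := cA x y (Itv01 t0 t1) (mem_set Ax) (mem_set Ay).
Qed.

Lemma convex_hull_convex (A : set X) : convex_set (smallest (@convex_set R X) A).
Proof.
move=> x y t /set_mem hx /set_mem hy; apply/mem_set => B [cB AB].
have xB : B x by apply: hx.
have yB : B y by apply: hy.
exact: set_mem (cB x y t (mem_set xB) (mem_set yB)).
Qed.

Lemma convex_set_mean (A : set X) (u : nat -> X) n :
  convex_set A -> (forall i, A (u i)) ->
  A (n.+1%:R^-1 *: \sum_(i < n.+1) u i).
Proof.
move=> cA Au; elim: n => [|n IH]; first by rewrite big_ord1 invr1 scale1r.
pose t : R := n.+1%:R / n.+2%:R.
have t0 : 0 <= t by rewrite divr_ge0.
have t1 : t <= 1 by rewrite ler_pdivrMr// mul1r ler_nat.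
have n2 : n.+2%:R != 0 :> R by [].
suff <- : t *: (n.+1%:R^-1 *: \sum_(i < n.+1) u i) + (1 - t) *: u n.+1 =
    n.+2%:R^-1 *: \sum_(i < n.+2) u i by exact: convex_set_comb.
rewrite [in RHS]big_ord_recr/= scalerDr scalerA; congr (_ *: _ + _ *: _).
  by rewrite /t mulrAC divff ?mul1r.
rewrite /t; apply: (mulIf n2); rewrite mulVf// mulrBl mul1r divfK//.
by rewrite -addn1 natrD addrAC subrr add0r.
Qed.

Lemma convex_unit_ball : convex_set [set y : X | `|y| <= 1].
Proof.
move=> x y t /set_mem/= hx /set_mem/= hy; apply/mem_set.
rewrite /= (le_trans (ler_normD _ _))// !normrZ.
have t0 : 0 <= t%:num by [].
have t1 : t%:num <= 1 by [].
rewrite /= !ger0_norm ?subr_ge0//.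
have t1' : 0 <= 1 - t%:num by lra.
have := ler_wpM2l t0 hx; have := ler_wpM2l t1' hy.
set a := t%:num * `|x|; set b := _ * `|y|; lra.
Qed.

End convexity.

(** * One-sided Lipschitz bounds *)

Section klip.
Context {R : realType} {M : metricType R}.
Implicit Types (k : R) (f g : M -> R).

Definition klip k f := forall x y, f x - f y <= k * mdist x y.

Lemma klip_norm k f x y : klip k f -> `|f x - f y| <= k * mdist x y.
Proof.
move=> fk; rewrite ler_norml; apply/andP; split; last exact: fk.
by rewrite lerNl opprB metric_sym; exact: fk.
Qed.

Lemma norm_klip k f : (forall x y, `|f x - f y| <= k * mdist x y) -> klip k f.
Proof. by move=> fk x y; exact: le_trans (ler_norm _) (fk x y). Qed.

(** At each of [x] and [y] at most one summand is nonzero, so at most two indices contribute to the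
    difference, whatever [n]. *)
Lemma sum_disjoint_le k (h : nat -> M -> R) n :
    0 <= k -> (forall i, klip k (h i)) ->
    (forall i j z, i <> j -> h i z = 0 \/ h j z = 0) ->
  klip (2 * k) (fun z => \sum_(i < n) h i z).
Proof.
move=> k0 hk dh x y.
have one z : \sum_(i < n) (h i z != 0)%:R <= 1 :> R.
  have -> : \sum_(i < n) (h i z != 0)%:R = #|[pred i : 'I_n | h i z != 0]|%:R :> R.
    rewrite -sum1_card natr_sum [in RHS]big_mkcond/=.
    by apply: eq_bigr => i _; rewrite inE; case: (h i z != 0).
  rewrite -[leRHS]/1%:R ler_nat.
  apply/card_le1_eqP => i j; rewrite !inE => hi hj; apply/val_inj.
  have [//|/eqP ij] := eqVneq (i : nat) j.
  by case: (dh i j z ij) => e; [move: hi|move: hj]; rewrite e eqxx.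
have D0 : 0 <= k * mdist x y by rewrite mulr_ge0 ?mdist_ge0.
rewrite -sumrB.
apply: (@le_trans _ _ (\sum_(i < n)
  ((h i x != 0)%:R * (k * mdist x y) + (h i y != 0)%:R * (k * mdist x y)))).
  apply: ler_sum => i _.
  have [hx|hx] := eqVneq (h i x) 0; have [hy|hy] := eqVneq (h i y) 0.
  - by rewrite hx hy subrr !mul0r addr0.
  - by rewrite mul0r add0r mul1r hk.
  - by rewrite mul1r mul0r addr0 hk.
  - by rewrite !mul1r (le_trans (hk i x y))// lerDl.
rewrite big_split/= -!mulr_suml -mulrA [2 * _]mulrDl mul1r.
by apply: lerD; rewrite -[leRHS]mul1r ler_wpM2r.
Qed.

End klip.

(** * From flippable functions to Daugavet-points *)

Section flippable.
Context {R : realType} {M : metricType R}.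

Definition flippable (f : M -> R) := klip 1 f /\
  forall (d : R) (g : M -> R), 0 < d -> d < 1 -> klip 1 g ->
  exists G : nat -> M -> R,
    [/\ forall n, klip (1 + d) (G n),
        forall n, exists x y, [/\ x != y &
          (2 - d) * mdist x y <= (f x - f y) - (G n x - G n y)] &
        forall i j z, i <> j -> G i z = g z \/ G j z = g z].

Context (o : M).

Lemma lip0_subP k (f : M -> R) : klip k f ->
  (fun x => f x - f o : R^o) \in @lip0_pred R M o.
Proof.
move=> fk; apply/asboolP; split; first exact: subrr.
exists k => x y; rewrite opprB addrA subrK.
exact: klip_norm.
Qed.

Definition lip0_sub k (f : M -> R) (fk : klip k f) : Lip0 o := MkLip0 (lip0_subP fk).

Lemma lip0_norm_le k (f : Lip0 o) : 0 <= k ->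
  klip k (f : M -> R) -> `|f| <= k.
Proof. by move=> k0 fk; apply: lip_const_le => // x y; exact: klip_norm. Qed.

Lemma lip0_klip (f : Lip0 o) : klip `|f| (f : M -> R).
Proof. by apply: norm_klip => x y; exact: lip_constP. Qed.

Lemma lip0_norm_ge k (f : Lip0 o) x y : x != y ->
  k * mdist x y <= f x - f y -> k <= `|f|.
Proof.
move=> xy kf; rewrite -(@ler_pM2r _ (mdist x y)) ?mdist_gt0//.
exact: le_trans kf (lip0_klip f x y).
Qed.

Lemma lip0_sumE n (F : nat -> Lip0 o) z :
  (\sum_(i < n) F i : Lip0 o) z = \sum_(i < n) F i z.
Proof.
by elim: n => [|n IH]; rewrite ?big_ord0// !big_ord_recr/= fctE IH.
Qed.

Lemma flippable_daugavet (f : M -> R) (ff : flippable f) :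
  daugavet_point (lip0_sub ff.1).
Proof.
case: ff => f1 flip /=; set F := lip0_sub f1.
have F1 : `|F| <= 1.
  by apply: lip0_norm_le => // x y; rewrite /= opprB addrA subrK; exact: f1.
(* [Y n] is [G n] shifted to vanish at [o] and divided by [1 + d], which costs at most [d] in norm.
   The constant 6 is 2 * 3: the [g - G n] are 3-Lipschitz with disjoint supports. *)
have main d (g : Lip0 o) : 0 < d -> d < 1 -> `|g| <= 1 ->
    exists Y : nat -> Lip0 o,
    [/\ forall n, `|Y n| <= 1, forall n, 2 - 2 * d <= `|F - Y n| &
     forall n, `|g - n.+1%:R^-1 *: \sum_(i < n.+1) Y i| <= d + 6 / n.+1%:R].
  move=> d0 d1 g1.
  have kg : klip 1 (g : M -> R).
    move=> x y; apply: (le_trans (lip0_klip g x y)).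
    by rewrite ler_wpM2r ?mdist_ge0.
  have [G [Gk Gf Gd]] := flip d g d0 d1 kg.
  pose G' n := lip0_sub (Gk n).
  have G'n n : `|G' n| <= 1 + d.
    apply: lip0_norm_le; first lra.
    by move=> x y; rewrite /= opprB addrA subrK; exact: Gk.
  pose t : R := (1 + d)^-1.
  have t0 : 0 < t by rewrite invr_gt0; lra.
  have td : t * (1 + d) = 1 by rewrite /t mulVf//; lra.
  have t1 : t <= 1 by nra.
  have YG n : `|G' n - t *: G' n| <= d.
    rewrite -{1}[G' n]scale1r -scalerBl normrZ ger0_norm; last by lra.
    have := G'n n; have := normr_ge0 (G' n); nra.
  exists (fun n => t *: G' n); split.
  - move=> n; rewrite normrZ gtr0_norm//; have := G'n n; nra.
  - move=> n; have [x [y [xy h]]] := Gf n.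
    have : 2 - d <= `|F - G' n|.
      apply: (lip0_norm_ge xy); apply: le_trans h _.
      by rewrite /= !fctE /=; lra.
    move=> h1; have := YG n; have := ler_normD (F - t *: G' n) (t *: G' n - G' n).
    by rewrite addrA subrK [in X in _ <= _ + X](distrC) /=; lra.
  - move=> n.
    pose H (i : nat) : M -> R := fun z => g z - G i z.
    have Hk i : klip 3 (H i).
      move=> x y; have := Gk i y x; have := kg x y.
      rewrite /H (metric_sym y) => a b; have := mdist_ge0 x y; nra.
    have Hd i j z : i <> j -> H i z = 0 \/ H j z = 0.
      by move=> ij; rewrite /H; case: (Gd i j z ij) => ->; rewrite subrr; [left|right].
    have Hs := @sum_disjoint_le _ _ 3 H n.+1 ltac:(lra) Hk Hd.
    have n0 : 0 < n.+1%:R :> R by [].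
    have gG : `|g - n.+1%:R^-1 *: \sum_(i < n.+1) G' i| <= 6 / n.+1%:R.
      have -> : g - n.+1%:R^-1 *: \sum_(i < n.+1) G' i =
          n.+1%:R^-1 *: \sum_(i < n.+1) (g - G' i).
        by rewrite sumrB scalerBr sumr_const card_ord -[g *+ n.+1]scaler_nat
           scalerA mulVf ?gt_eqF// scale1r.
      rewrite normrZ gtr0_norm ?invr_gt0// [leLHS]mulrC ler_pM2r ?invr_gt0//.
      apply: lip0_norm_le => // x y.
      rewrite (@lip0_sumE _ (fun i => g - G' i)) (@lip0_sumE _ (fun i => g - G' i)).
      have := Hs x y; rewrite -!sumrB => h.
      apply: le_trans (le_trans _ h) _; last by rewrite -natrM.
      by apply: ler_sum => i _; rewrite /H /= !fctE /=; lra.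
    set S' := n.+1%:R^-1 *: _ in gG; set S := n.+1%:R^-1 *: _.
    have -> : g - S = (S' - S) + (g - S') by rewrite [RHS]addrC addrA subrK.
    apply: (le_trans (ler_normD _ _)); apply: lerD => //.
    rewrite /S' /S -scalerBr -sumrB normrZ gtr0_norm ?invr_gt0// [leLHS]mulrC.
    rewrite ler_pdivrMr//; apply: (le_trans (ler_norm_sum _ _ _)).
    apply: (@le_trans _ _ (\sum_(i < n.+1) d)); first by apply: ler_sum => i _; exact: YG.
    by rewrite sumr_const card_ord mulr_natr.
split.
  (* Perturbing [g = 0] gives a [Y 0] of norm at most 1 at distance at least [2 - 2 * d] from [F],
     so [F] has norm at least [1 - e]. *)
  apply/eqP; rewrite eq_le F1/=; apply/ler_addgt0Pl => e e0.
  pose d := Num.min (e / 2) (1 / 2).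
  have d0 : 0 < d by rewrite lt_min; apply/andP; split; lra.
  have d1 : d < 1 by rewrite gt_min; apply/orP; right; lra.
  have de : d <= e / 2 by rewrite ge_min lexx.
  have [|Y [Y1 Y2 _]] := main d 0 d0 d1; first by rewrite normr0.
  have := ler_normB F (Y 0%N); have := Y1 0%N; have := Y2 0%N; lra.
move=> e e0; apply/seteqP; split.
  move=> g /= g1 B /nbhs_ballP[r /= r0 rB].
  pose d := Num.min (Num.min (e / 2) (r / 2)) (1 / 2).
  have d0 : 0 < d by rewrite !lt_min -andbA; apply/and3P; split; lra.
  have d1 : d < 1 by rewrite gt_min; apply/orP; right; lra.
  have de : d <= e / 2 by rewrite !ge_min lexx.
  have dr : d <= r / 2 by rewrite !ge_min lexx orbT.
  have [Y [Y1 Y2 Y3]] := main d g d0 d1 g1.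
  (* Makes [6 / n.+1%:R] less than [r / 2]; the other half of [r] is for [d]. *)
  pose n := Num.truncn (12 / r).
  exists (n.+1%:R^-1 *: \sum_(i < n.+1) Y i); split.
    apply: convex_set_mean; first exact: convex_hull_convex.
    move=> i; apply: sub_gen_smallest; split; first exact: Y1.
    by have := Y2 i; lra.
  apply: rB; rewrite -ball_normE /=; apply: (le_lt_trans (Y3 n)).
  have rn : 12 / r < n.+1%:R by exact: truncnS_gt.
  suff h : 6 / n.+1%:R < r / 2 by rewrite (splitr r) ler_ltD.
  by move: rn; rewrite !ltr_pdivrMr//; set N := n.+1%:R; lra.
(* The reverse inclusion: the unit ball is closed and convex. *)
have cB : closed [set y : Lip0 o | `|y| <= 1].
  have := @closed_closed_ball_ R (Lip0 o) 0 1.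
  congr closed; apply/seteqP; split => y; rewrite /closed_ball_ /= sub0r normrN//.
rewrite [X in _ `<=` X](closure_id _).1//; apply: closure_subset.
by apply: smallest_sub => [|y []//]; exact: convex_unit_ball.
Qed.

End flippable.

(** Dependent choice with full history: [s n] lists the first [n] terms, and [F] picks the next one
    against all of them. *)
Lemma seq_choice (T : eqType) (P : nat -> T -> Prop) (Q : T -> T -> Prop) :
    (forall s : seq T, exists x, P (size s) x /\ {in s, forall y, Q y x}) ->
  exists u : nat -> T,
    (forall n, P n (u n)) /\ (forall m n, (m < n)%N -> Q (u m) (u n)).
Proof.
move=> /choice[F FP]; pose s n := iter n (fun s => rcons s (F s)) [::].
have sz n : size (s n) = n by elim: n => //= n IH; rewrite size_rcons IH.
exists (F \o s); split=> [n|m n mn]; first by have [+ _] := FP (s n); rewrite sz.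
apply: (FP (s n)).2; elim: n mn => // n IH; rewrite ltnS leq_eqVlt.
by rewrite mem_rcons inE => /predU1P[->|/IH ->]; rewrite ?eqxx ?orbT.
Qed.

(** * Clipping by cones *)

Section constructions.
Context {R : realType} {M : metricType R}.
Implicit Types (k c e : R) (f g phi : M -> R).

Lemma klip_max k f g : klip k f -> klip k g -> klip k (fun z => Num.max (f z) (g z)).
Proof.
move=> fk gk x y; rewrite lerBlDr ge_max; apply/andP; split.
  have : f y <= Num.max (f y) (g y) by rewrite le_max lexx.
  by have := fk x y; lra.
have : g y <= Num.max (f y) (g y) by rewrite le_max lexx orbT.
by have := gk x y; lra.
Qed.

Lemma klip_opp k f : klip k f -> klip k (fun z => - f z).
Proof. by move=> fk x y; have := fk y x; rewrite metric_sym; lra. Qed.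

Lemma klip_min k f g : klip k f -> klip k g -> klip k (fun z => Num.min (f z) (g z)).
Proof.
move=> fk gk x y; have := klip_opp (klip_max (klip_opp fk) (klip_opp gk)) x y.
by rewrite -!oppr_min !opprK.
Qed.

Lemma klip_cone k c (x : M) : 0 <= k -> klip k (fun z => c + k * mdist z x).
Proof.
by move=> k0 y z; have := ler_wpM2l k0 (metric_triangle y z x); rewrite mulrDr; lra.
Qed.

Definition clip k c (x : M) g (z : M) : R :=
  Num.max (c - k * mdist z x) (Num.min (g z) (c + k * mdist z x)).

Lemma clip_klip k c (x : M) g : 1 <= k -> klip 1 g -> klip k (clip k c x g).
Proof.
move=> k1 g1; have k0 : 0 <= k by lra.
apply: klip_max; last apply: klip_min; last exact: klip_cone.
  move=> y z; have := klip_opp (klip_cone (- c) x k0) y z; lra.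
by move=> y z; apply: le_trans (g1 y z) _; rewrite ler_wpM2r ?mdist_ge0.
Qed.

Lemma clip_center k c x g : clip k c x g x = c.
Proof. by rewrite /clip mdistxx mulr0 subr0 addr0 max_l // ge_min lexx orbT. Qed.

Lemma clip_out k c x g z : `|g z - c| <= k * mdist z x -> clip k c x g z = g z.
Proof.
rewrite ler_norml => /andP[a b]; rewrite /clip min_l; last by lra.
by rewrite max_r//; lra.
Qed.

(** * Distance to a point of the completion *)

(* [phi] behaves as the distance to a point of the completion of [M]. *)
Definition katetov phi := forall x y,
  phi x - phi y <= mdist x y /\ mdist x y <= phi x + phi y.

Lemma katetov_ge0 phi x : katetov phi -> 0 <= phi x.
Proof. by move=> /(_ x x)[_]; rewrite mdistxx; lra. Qed.

Lemma katetov_flippable phi : katetov phi ->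
    (forall e, 0 < e -> exists w, phi w < e) ->
    (forall e (s : seq M), 0 < e -> exists x, 0 < phi x /\
      {in s, forall y, 0 < phi y -> phi x <= e * phi y \/ phi y <= e * phi x}) ->
  flippable phi.
Proof.
move=> kphi phi0 scales.
have phi1 : klip 1 phi by move=> x y; rewrite mul1r; exact: (kphi x y).1.
(* This [e] satisfies [(2 + d) * e <= d], which keeps clipping inactive at remote scales, and
   [(4 - d) * e <= d], which gives the slope [2 - d]. *)
split=> // d g d0 d1 g1; pose e := d / 4.
have e0 : 0 < e by rewrite /e; lra.
have [u [u0 uQ]] :=
  @seq_choice _ (fun=> fun x => 0 < phi x) _ ((scales (e * e))^~ (mulr_gt0 e0 e0)).
(* [L] serves as the value of [g] at the point [p] from which [phi] measures distance: by [L1] and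
   [L2], [g z] and [L] differ by at most [phi z]. *)
pose S := [set g z - phi z | z in [set: M]].
have gphi z w : g z - phi z <= g w + phi w.
  by have := g1 z w; have [_] := kphi z w; lra.
have [w0 _] := phi0 1 ltr01.
have ubS : has_ubound S by exists (g w0 + phi w0) => _ [z _ <-].
pose L := sup S.
have L1 z : g z - phi z <= L by apply: ub_le_sup => //; exists z.
have L2 z : L <= g z + phi z.
  by apply: ge_sup => [|_ [w _ <-]//]; exists (g w0 - phi w0); exists w0.
(* From a point near [p] to [u n], [phi] rises and [G n] falls, both by about [phi (u n)]. *)
pose G n := clip (1 + d) (L - phi (u n)) (u n) g.
have keep n z : phi z <= e * phi (u n) \/ phi (u n) <= e * phi z -> G n z = g z.
  move=> h; apply: clip_out; have := u0 n; have := katetov_ge0 z kphi.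
  have := L1 z; have := L2 z; have := (kphi z (u n)).1.
  have := (kphi (u n) z).1; rewrite (metric_sym _ z).
  move: (phi z) (phi (u n)) (mdist z (u n)) h => a b D h h1 h2 h3 h4 a0 b0.
  have gab : `|g z - (L - b)| <= a + b by rewrite ler_norml; apply/andP; split; lra.
  apply: le_trans gab _.
  have ad : 0 <= a * d * (1 - d) by rewrite mulr_ge0 ?mulr_ge0//; lra.
  have bd : 0 <= b * d * (1 - d) by rewrite mulr_ge0 ?mulr_ge0//; lra.
  have ad' : 0 <= a * d by rewrite mulr_ge0; lra.
  have bd' : 0 <= b * d by rewrite mulr_ge0; lra.
  case: h => h.
    have : (1 + d) * (b - a) <= (1 + d) * D by rewrite ler_wpM2l; lra.
    apply: le_trans; have : (2 + d) * a <= (2 + d) * (e * b) by rewrite ler_wpM2l; lra.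
    rewrite /e; nra.
  have : (1 + d) * (a - b) <= (1 + d) * D by rewrite ler_wpM2l; lra.
  apply: le_trans; have : (2 + d) * b <= (2 + d) * (e * a) by rewrite ler_wpM2l; lra.
  rewrite /e; nra.
exists G; split.
- by move=> n; apply: clip_klip => //; lra.
- move=> n; have [w hw] := phi0 (e * phi (u n)) (mulr_gt0 e0 (u0 n)).
  exists (u n), w; split.
    apply/eqP => uw; move: hw; rewrite -uw; have := u0 n; rewrite /e; nra.
  rewrite (keep n w); last by left; exact: ltW.
  rewrite /G clip_center; have := L2 w; have := L1 w; have := (kphi (u n) w).2.
  move: hw (katetov_ge0 w kphi) (u0 n).
  move: (phi w) (phi (u n)) (mdist _ _) => a b D ha a0 b0 h1 h2 h3.
  have : (2 - d) * D <= (2 - d) * (a + b) by rewrite ler_wpM2l; lra.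
  move/le_trans; apply; move: ha; rewrite /e => ha; nra.
move=> i j z ij.
(* [G i] differs from [g] only where [phi z] lies between [e * phi (u i)] and [phi (u i) / e]; a
   ratio [e * e] between scales makes these ranges disjoint. *)
have sep : phi (u j) <= e * e * phi (u i) \/ phi (u i) <= e * e * phi (u j).
  case: (ltngtP i j) => [h|h|//]; have := uQ _ _ h (u0 _) => -[]; by [left|right].
have [h|h1] := leP (phi z) (e * phi (u i)); first by left; apply: keep; left.
have [h|h2] := leP (phi (u i)) (e * phi z); first by left; apply: keep; right.
have [h|h3] := leP (phi z) (e * phi (u j)); first by right; apply: keep; left.
have [h|h4] := leP (phi (u j)) (e * phi z); first by right; apply: keep; right.
by exfalso; case: sep; rewrite -mulrA => sep; nra.
Qed.

(** Provides the scale condition of [katetov_flippable]: go below [e] times a positive lower bound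
    of the positive values of [phi] on [s]. *)
Lemma small_scales phi : (forall e, 0 < e -> exists x, 0 < phi x /\ phi x < e) ->
  forall e (s : seq M), 0 < e -> exists x, 0 < phi x /\
    {in s, forall y, 0 < phi y -> phi x <= e * phi y \/ phi y <= e * phi x}.
Proof.
move=> small e s e0.
have [r [r0 rs]] : exists r, 0 < r /\ {in s, forall y, 0 < phi y -> r <= phi y}.
  elim: s => [|x s [r [r0 rs]]]; first by exists 1.
  have [x0|x0] := leP (phi x) 0.
    exists r; split=> // y; rewrite inE => /predU1P[->|]; [lra|exact: rs].
  exists (Num.min r (phi x)); split; first by rewrite lt_min r0.
  move=> y; rewrite inE ge_min => /predU1P[->|/rs h y0]; first by rewrite lexx orbT.
  by rewrite h.
have [x [x0 xr]] := small (e * r) (mulr_gt0 e0 r0).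
exists x; split=> // y ys y0; left; apply: le_trans (ltW xr) _.
by rewrite ler_pM2l//; exact: rs.
Qed.

(** The same condition at the other end: go beyond [c / e], where [c] bounds [phi] on [s]. *)
Lemma large_scales phi : (forall c, exists x, c < phi x) ->
  forall e (s : seq M), 0 < e -> exists x, 0 < phi x /\
    {in s, forall y, 0 < phi y -> phi x <= e * phi y \/ phi y <= e * phi x}.
Proof.
move=> large e s e0.
have [c [c0 cs]] : exists c, 0 < c /\ {in s, forall y, phi y <= c}.
  elim: s => [|x s [c [c0 cs]]]; first by exists 1.
  exists (Num.max c (phi x)); split; first by rewrite lt_max c0.
  move=> y; rewrite inE le_max => /predU1P[->|/cs ->//]; by rewrite lexx orbT.
have [x xc] := large (c / e).
exists x; split; first by apply: lt_trans xc; rewrite divr_gt0.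
move=> y ys y0; right; apply: le_trans (cs y ys) _.
by rewrite mulrC -ler_pdivrMr// ltW.
Qed.

(** * Close pairs with separated first points *)

Lemma separated_flippable (x y : nat -> M) c : 0 < c ->
    (forall n, x n != y n) -> (forall n, mdist (x n) (y n) < c / n.+4%:R) ->
    (forall m n, m <> n -> c <= mdist (x m) (x n)) ->
  flippable (fun z => inf [set mdist z (y n) | n in [set: nat]]).
Proof.
move=> c0 xy rc sep; set f := fun z => _.
have lbD z : has_lbound [set mdist z (y n) | n in [set: nat]].
  by exists 0 => _ [n _ <-]; exact: mdist_ge0.
have f_le z n : f z <= mdist z (y n) by apply: ge_inf => //; exists n.
have f_ge z t : (forall n, t <= mdist z (y n)) -> t <= f z.
  move=> h; apply: lb_le_inf; first by exists (mdist z (y 0%N)); exists 0%N.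
  by move=> _ [n _ <-].
have f1 : klip 1 f.
  move=> z w; rewrite mul1r lerBlDr -lerBlDl; apply: f_ge => n.
  by have := f_le z n; have := metric_triangle z w (y n); lra.
(* Starting the denominators at 4 keeps [y m] with [m <> n] at least [3 * c / 4] away from [x n], so
   [y n] is nearest to [x n]. *)
have r4 n : mdist (x n) (y n) <= c / 4.
  apply: le_trans (ltW (rc n)) _.
  by rewrite ler_pM2l// lef_pV2 ?posrE// ler_nat.
have fy n : f (y n) = 0.
  apply/eqP; rewrite eq_le -{1}(mdistxx (y n)) f_le/=.
  by apply: f_ge => m; exact: mdist_ge0.
have fx n : f (x n) = mdist (x n) (y n).
  apply/eqP; rewrite eq_le f_le/=; apply: f_ge => m.
  have [->//|/eqP mn] := eqVneq m n.
  have := sep _ _ mn; have := r4 m; have := r4 n.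
  have := metric_triangle (x m) (y m) (x n); rewrite (metric_sym (y m)); lra.
split=> // d g d0 d1 g1.
(* Dropping the first [k] pairs ensures [2 * r n <= d * (c / 2)]: at distance at least [c / 2] from
   [x n], the extra slope [d] absorbs the error [2 * r n]. *)
pose k := Num.truncn (4 / d).
have kd : 4 / d < k.+1%:R by exact: truncnS_gt.
pose r n := mdist (x n) (y n).
(* From [y n] to [x n], with [n = k + i], [f] rises by [r n] and [G i] falls by [r n]: slope 2. *)
pose G i := clip (1 + d) (g (y (k + i)%N) - r (k + i)%N) (x (k + i)%N) g.
have keep i z : c / 2 <= mdist z (x (k + i)%N) -> G i z = g z.
  set n := (k + i)%N => h; apply: clip_out.
  have dr : d * (c / 2) >= 2 * r n.
    have : r n < c / n.+4%:R := rc n.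
    have : 4 / d < n.+4%:R.
      by apply: lt_le_trans kd _; rewrite ler_nat /n -addn4 -addn1 leq_add ?leq_addr.
    rewrite ltr_pdivrMr// ltr_pdivlMr//; set N : R := n.+4%:R => h1 h2.
    have r0 : 0 <= r n by exact: mdist_ge0.
    have : r n * 4 <= r n * (N * d) by rewrite ler_wpM2l// ltW.
    have : r n * N * d <= c * d by rewrite ler_wpM2r// ltW.
    by rewrite mulrA; lra.
  have gz := klip_norm z (y n) g1.
  have tri := metric_triangle z (x n) (y n).
  have r0 : 0 <= r n := mdist_ge0 _ _.
  have dh : d * (c / 2) <= d * mdist z (x n) by rewrite ler_wpM2l// ltW.
  rewrite opprB addrCA addrC; apply: (le_trans (ler_normD _ _)).
  rewrite (ger0_norm r0) mulrDl mul1r; move: gz; rewrite mul1r -/(r n) in tri *.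
  lra.
exists G; split.
- by move=> i; apply: clip_klip => //; lra.
- move=> i; exists (x (k + i)%N), (y (k + i)%N); split; first exact: xy.
  rewrite fx fy /G clip_center clip_out.
    have := mdist_ge0 (x (k + i)%N) (y (k + i)%N); rewrite /r; nra.
  rewrite opprB addrCA subrr addr0 /r (metric_sym (y _)) ger0_norm ?mdist_ge0//.
  rewrite ler_peMl ?mdist_ge0//; lra.
move=> i j z ij.
have [h|h1] := leP (c / 2) (mdist z (x (k + i)%N)); first by left; exact: keep.
have [h|h2] := leP (c / 2) (mdist z (x (k + j)%N)); first by right; exact: keep.
have /sep : (k + i)%N <> (k + j)%N by move=> /addnI.
have := metric_triangle (x (k + i)%N) z (x (k + j)%N).
by rewrite (metric_sym _ z); lra.
Qed.

(** * Ultrafilters and the dichotomy for close pairs *)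

Lemma ultra_seq (U : set_system M) (s : seq M) (A : M -> set M) :
    UltraFilter U -> U [set x | exists2 z, z \in s & A z x] ->
  exists2 z, z \in s & U (A z).
Proof.
move=> UU; elim: s => [|a s IH] Us.
  exfalso; apply: (@filter_not_empty _ U); apply: filterS Us.
  by move=> x [z]; rewrite in_nil.
have [Ua|Ua] := in_ultra_setVsetC (A a) UU; first by exists a; rewrite ?mem_head.
have [|z zs Uz] := IH; last by exists z; rewrite // inE zs orbT.
apply: filterS (filterI Us Ua) => x [[z]]; rewrite inE => /predU1P[->//|zs Az] _.
by exists z.
Qed.

(** The covering hypothesis makes an ultrafilter [U] containing every [T e] Cauchy; its limit in the
    completion, possibly in [M] itself, is the point [p]. *)
Lemma clustering_flippable :
    (forall e, 0 < e -> exists x y : M, x != y /\ mdist x y < e) ->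
    (forall c, 0 < c -> exists e (s : seq M), 0 < e /\ forall x y : M,
      x != y -> mdist x y < e -> exists2 z, z \in s & mdist z x < c) ->
  exists phi, flippable phi.
Proof.
move=> close cover.
pose T e : set M := [set x | exists2 y, x != y & mdist x y < e].
have FF : ProperFilter (filter_from [set e | 0 < e] T).
  apply: filter_from_proper; last by move=> e /close[x [y [xy xye]]]; exists x; exists y.
  apply: filter_from_filter; first by exists 1; exact: ltr01.
  move=> a b a0 b0; exists (Num.min a b); first by rewrite /= lt_min a0.
  by move=> x [y xy]; rewrite lt_min => /andP[xa xb]; split; exists y.
have [U [UU FU]] := ultraFilterLemma FF.
have UT e : 0 < e -> U (T e) by move=> e0; apply: FU; exists e.
have Uball c : 0 < c -> exists z, U [set x | mdist z x < c].
  move=> c0; have [e [s [e0 es]]] := cover c c0.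
  have [|z _ Uz] := @ultra_seq U s (fun z => [set x | mdist z x < c]) UU;
    last by exists z.
  by apply: filterS (UT e e0) => x [y xy xye]; exact: es xy xye.
(* [phi z] is the limit of [mdist z x] as [x] follows [U]. *)
pose S z : set R := [set t | U [set x | mdist z x < t]].
pose phi z := inf (S z).
have meet A B : U A -> U B -> A `&` B !=set0.
  by move=> UA UB; apply: (@filter_ex _ U); exact: filterI.
have S0 z : S z !=set0.
  have [w Uw] := Uball 1 ltr01; exists (mdist z w + 1).
  apply: filterS Uw => x /= wx; have := metric_triangle z w x; lra.
have lbS z : lbound (S z) 0.
  move=> t St; have [x [+ _]] := meet _ _ St St.
  by move=> /ltW; exact: le_trans (mdist_ge0 _ _).
have phi_le z t : S z t -> phi z <= t.
  by move=> St; apply: ge_inf => //; exists 0.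
have kphi : katetov phi.
  move=> x y; split.
    rewrite lerBlDr -lerBlDl; apply: lb_le_inf => // t St.
    rewrite lerBlDl; apply: phi_le; apply: filterS St => z /= yz.
    by have := metric_triangle x y z; lra.
  rewrite -lerBlDr; apply: lb_le_inf => // t St.
  rewrite lerBlDr -lerBlDl; apply: lb_le_inf => // t' St'.
  have [z [/= xz yz]] := meet _ _ St St'.
  by have := metric_triangle x z y; rewrite (metric_sym z); lra.
exists phi; apply: katetov_flippable => //.
  move=> e e0; have [|z Uz] := Uball (e / 2); first lra.
  by exists z; have := phi_le z _ Uz; lra.
apply: small_scales => e e0.
have e3 : 0 < e / 3 by lra.
have [z Uz] := Uball _ e3.
have [x [/= zx [y xy xye]]] := meet _ _ Uz (UT _ e3).
have phiz := phi_le z _ Uz.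
have := (kphi x z).1; rewrite (metric_sym x z) => xz.
have := (kphi y x).1; rewrite (metric_sym y x) => yx.
have := (kphi x y).2; have : 0 < mdist x y by rewrite mdist_gt0.
move=> xy0 xyphi.
(* [phi x] vanishes if [x] is the limit of [U]; then its partner [y] has [phi y > 0], as
   [mdist x y <= phi x + phi y]. *)
have [x0|x0] := ltP 0 (phi x); first by exists x; split => //; lra.
by exists y; split; lra.
Qed.

Lemma close_pairs_flippable :
    (forall e, 0 < e -> exists x y : M, x != y /\ mdist x y < e) ->
  exists f, flippable f.
Proof.
move=> close.
have [|ncover] := pselect (forall c, 0 < c -> exists e (s : seq M), 0 < e /\
  forall x y : M, x != y -> mdist x y < e -> exists2 z, z \in s & mdist z x < c).
  exact: clustering_flippable.
(* Failure of covering at scale [c]: arbitrarily short pairs start at distance at least [c] from any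
   finite set, which is what [seq_choice] requires. *)
have [c c0 far] : exists2 c, 0 < c & forall e (s : seq M), 0 < e ->
    exists p : M * M, [/\ p.1 != p.2, mdist p.1 p.2 < e &
      {in s, forall z, c <= mdist z p.1}].
  apply: contrapT => nfar; apply: ncover => c c0; apply: contrapT => nc.
  apply: nfar; exists c => // e s e0; apply: contrapT => np; apply: nc.
  exists e, s; split=> // x y xy xye; apply: contrapT => nz; apply: np.
  exists (x, y); split=> // z zs; rewrite leNgt; apply/negP => zx.
  by apply: nz; exists z.
have [|u [uP uQ]] := @seq_choice (M * M)%type
  (fun n p => p.1 != p.2 /\ mdist p.1 p.2 < c / n.+4%:R)
  (fun p q => c <= mdist p.1 q.1).
  move=> s; have [|p [p1 p2 ps]] := far (c / (size s).+4%:R) (map fst s).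
    by rewrite divr_gt0.
  by exists p; split=> // q qs; apply: ps; exact: map_f.
eexists; apply: (@separated_flippable (fst \o u) (snd \o u) c) => //=.
- by move=> n; exact: (uP n).1.
- by move=> n; exact: (uP n).2.
move=> m n /eqP; rewrite neq_lt => /orP[/uQ//|/uQ].
by rewrite metric_sym.
Qed.

(** * The two hypotheses on the space *)

Lemma unbounded_flippable (o : M) : ~ metric_bounded M -> flippable (mdist o).
Proof.
move=> unb; apply: katetov_flippable.
- move=> x y; split.
    by have := metric_triangle o y x; rewrite (metric_sym y); lra.
  by have := metric_triangle x o y; rewrite (metric_sym x o).
- by move=> e e0; exists o; rewrite mdistxx.
apply: large_scales => c; apply: contrapT => nc; apply: unb.
exists (2 * c) => x y.
have dc z : mdist o z <= c by rewrite leNgt; apply/negP => h; apply: nc; exists z.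
have := dc x; have := dc y; have := metric_triangle x o y.
by rewrite (metric_sym x o); lra.
Qed.

Lemma not_uniformly_discrete_close : ~ uniformly_discrete M ->
  forall e, 0 < e -> exists x y : M, x != y /\ mdist x y < e.
Proof.
move=> nud e e0; apply: contrapT => ne; apply: nud.
apply: (@lt_le_trans _ _ e%:E); first by rewrite lte_fin.
apply: le_ereal_inf_tmp => _ [[x y] /= xy <-]; rewrite lee_fin leNgt.
by apply/negP => xye; apply: ne; exists x, y; split=> //; exact/eqP.
Qed.

End constructions.

Theorem corollary5p2 (R : realType) (M : metricType R) (o : M)
    (hM : ~ metric_bounded M \/ ~ uniformly_discrete M) :
  exists f : Lip0 o, daugavet_point f.
Proof.
have [f ff] : exists f : M -> R, flippable f.
  case: hM => [unb|nud]; first by exists (mdist o); exact: unbounded_flippable.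
  exact: close_pairs_flippable (not_uniformly_discrete_close nud).
by exists (lip0_sub o ff.1); exact: flippable_daugavet.
Qed.
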